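(* For any $\epsilon>0$, the random map $\Phi$ is almost surely in $\dot H^{1-d/2-\epsilon}(\Omega)$.
   Context: $\Omega\subset\mathbb{R}^d$, $d\ge1$, is a bounded, open, connected set with Lipschitz boundary. $\{\phi_k\}_{k\ge1}$ is an orthonormal basis of $L^2(\Omega)$ of eigenfunctions of the Dirichlet Laplacian, $-\Delta\phi_k=\lambda_k\phi_k$ in $\Omega$, $\phi_k=0$ on $\partial\Omega$, with $0<\lambda_1\le\lambda_2\le\cdots$; the eigenvalues satisfy Weyl's bounds $c\,k^{2/d}\le\lambda_k\le C\,k^{2/d}$ with constants $c,C>0$ depending on $\Omega$. For $s\ge0$, $\dot H^s(\Omega)=\{u\in L^2(\Omega):\lVert u\rVert_{\dot H^s}^2:=\sum_k\lambda_k^s|\langle u,\phi_k\rangle|^2<\infty\}$, and $\dot H^{-s}(\Omega)$ is its dual, i.e. the bounded linear functionals $R:\dot H^s(\Omega)\to\mathbb{R}$, with norm $\lVert R\rVert_{-s}^2=\sum_k\lambda_k^{-s}|R(\phi_k)|^2<\infty$. Functions in $L^2(\Omega)$ are regarded as elements of $\dot H^{-s}(\Omega)$ via the $L^2$ inner product $\langle\cdot,\cdot\rangle$. $\{w_k\}_{k\ge1}$ are independent real random variables with mean zero and unit variance on a probability space $(\Xi,\mathfrak{F},\mu)$, $\tau>0$ is fixed, and $$\Phi(\xi,\cdot)=\tau\sum_{k=1}^\infty(1+\lambda_k)^{-1/2}w_k(\xi)\phi_k(\cdot),\qquad \Phi^{(n)}(\xi,\cdot)=\tau\sum_{k=1}^n(1+\lambda_k)^{-1/2}w_k(\xi)\phi_k(\cdot).$$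 That $\Phi(\xi,\cdot)$ belongs to a space $\dot H^t(\Omega)$ means that the partial sums $\Phi^{(n)}(\xi,\cdot)$ converge in the norm of $\dot H^t(\Omega)$, the limit being $\Phi(\xi,\cdot)$. *)

(* Defs.v *)
From HB Require Import structures.
From mathcomp Require Import all_boot all_order all_algebra.
From mathcomp Require Import all_classical all_reals all_analysis.

Set Implicit Arguments.
Unset Strict Implicit.
Unset Printing Implicit Defensive.
Import Order.TTheory GRing.Theory Num.Theory.
Import numFieldNormedType.Exports.
Local Open Scope classical_set_scope.
Local Open Scope ring_scope.

Section measurable_rV.
Context (R : realType) (d : nat).

Let coord (i : 'I_d) (v : 'rV[R]_d) : R := v 0 i.

Let rV_set0 : g_sigma_preimage coord set0.
Proof. exact: sigma_algebra0. Qed.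

Let rV_setC A : g_sigma_preimage coord A -> g_sigma_preimage coord (~` A).
Proof. exact: sigma_algebraC. Qed.

Let rV_bigcup (F : (set 'rV[R]_d)^nat) :
  (forall i, g_sigma_preimage coord (F i)) ->
  g_sigma_preimage coord (\bigcup_i (F i)).
Proof. exact: sigma_algebra_bigcup. Qed.

(* The product sigma-algebra on R^d, which is the Borel one. *)
HB.instance Definition _ :=
  @isMeasurable.Build (measure_tuple_display (R.-ocitv.-measurable).-sigma)
    'rV[R]_d (g_sigma_preimage coord) rV_set0 rV_setC rV_bigcup.

Lemma measurable_coord (i : 'I_d) :
  measurable_fun [set: 'rV[R]_d] (fun v => v 0 i).
Proof.
move=> _ Y mY; rewrite setTI; apply: sub_sigma_algebra => /=.
rewrite -bigcup_seq/=; exists i => /=; first by rewrite mem_index_enum.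
by exists Y => //; rewrite setTI.
Qed.

Lemma measurable_fun_rV d' (T : measurableType d') (f : T -> 'rV[R]_d) :
  (forall i, measurable_fun [set: T] (fun x => f x 0 i)) ->
  measurable_fun [set: T] f.
Proof.
move=> mf; have sub : g_sigma_preimage (fun i => coord i \o f) `<=` measurable.
  apply: smallest_sub; first exact: sigma_algebra_measurable.
  move=> A; rewrite -bigcup_seq => -[i _] [B mB <-]; exact: mf.
rewrite g_sigma_preimage_comp in sub.
by move=> _ A mA; apply: sub; exists A.
Qed.

End measurable_rV.

Section lebesgue_rV.
Context (R : realType).

Definition cons_rV d (p : R * 'rV[R]_d) : 'rV[R]_d.+1 :=
  \row_i (if unlift ord0 i is Some j then p.2 0 j else p.1).

Definition uncons_rV d (v : 'rV[R]_d.+1) : R * 'rV[R]_d :=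
  (v 0 ord0, \row_j v 0 (lift ord0 j)).

Lemma cons_rVK d : cancel (@cons_rV d) (@uncons_rV d).
Proof.
move=> [x v]; rewrite /uncons_rV /cons_rV mxE unlift_none; congr pair.
by apply/rowP => j; rewrite !mxE liftK.
Qed.

Lemma uncons_rVK d : cancel (@uncons_rV d) (@cons_rV d).
Proof.
move=> v; apply/rowP => i; rewrite mxE; case: unliftP => [j ->|->] //=.
by rewrite mxE.
Qed.

Lemma measurable_cons_rV d : measurable_fun setT (@cons_rV d).
Proof.
apply: measurable_fun_rV => i; rewrite /cons_rV.
case: (unliftP ord0 i) => [j|] ->.
  under eq_fun do rewrite mxE liftK.
  apply: (measurableT_comp (measurable_coord j)); exact: measurable_snd.
under eq_fun do rewrite mxE unlift_none.
exact: measurable_fst.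
Qed.

Lemma measurable_uncons_rV d : measurable_fun setT (@uncons_rV d).
Proof.
apply/measurable_fun_pairP; split; first exact: measurable_coord.
apply: measurable_fun_rV => i /=.
under eq_fun do rewrite mxE.
exact: measurable_coord.
Qed.

Fixpoint lebesgue_rV (d : nat) : set 'rV[R]_d -> \bar R :=
  match d with
  | 0 => @dirac _ 'rV[R]_0 0 R
  | d'.+1 => pushforward
      (product_measure1 (@lebesgue_measure R) (lebesgue_rV (d := d')))
      (@cons_rV d')
  end.

Let lebesgue_rV_sfm d : exists m : {sigma_finite_measure set 'rV[R]_d -> \bar R},
  lebesgue_rV (d := d) = m.
Proof.
elim: d => [|d [m /= ->]]; first by exists (@dirac _ 'rV[R]_0 0 R).
pose p : {measure set (measurableTypeR R * 'rV[R]_d)%type -> \bar R} :=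
  product_measure1 (@lebesgue_measure R) m.
pose q : {measure set 'rV[R]_d.+1 -> \bar R} :=
  measure_function_pushforward__canonical__measure_function_Measure
    p (measurable_cons_rV (d := d)).
have qfin : sigma_finite setT q.
  have /sigma_finiteP[F [FT ndF Foo]] := sigma_finiteT (@lebesgue_measure R).
  have /sigma_finiteP[G [GT ndG Goo]] := sigma_finiteT m.
  exists (fun k => @uncons_rV d @^-1` (F k `*` G k)).
    apply/esym; rewrite -subTset => v _.
    have : (\bigcup_k F k) (v 0 ord0) by rewrite -FT.
    have : (\bigcup_k G k) (@uncons_rV d v).2 by rewrite -GT.
    move=> [i _ Gi] [j _ Fj]; exists (maxn i j) => //; split.
      by move: Fj; exact/subsetPset/ndF/leq_maxr.
    by move: Gi; exact/subsetPset/ndG/leq_maxl.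
  move=> k; have [mF pF] := Foo k; have [mG pG] := Goo k; split.
    rewrite -[X in measurable X]setTI; apply: measurable_uncons_rV => //.
    exact: measurableX.
  rewrite /= /pushforward -comp_preimage (_ : _ \o _ = id); last first.
    by apply/funext => x; exact: cons_rVK.
  rewrite preimage_id product_measure1E// lte_mul_pinfty// ge0_fin_numE//.
pose H := @Measure_isSigmaFinite.Build _ _ _ q qfin.
pose qs : {sigma_finite_measure set 'rV[R]_d.+1 -> \bar R} :=
  HB.pack_for {sigma_finite_measure set 'rV[R]_d.+1 -> \bar R}
    (q : set _ -> \bar R) (Measure.class q) H.
by exists qs.
Qed.

Let lebesgue_rV0 d : lebesgue_rV (set0 : set 'rV[R]_d) = 0%E.
Proof. by have [m ->] := lebesgue_rV_sfm d; exact: measure0. Qed.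

Let lebesgue_rV_ge0 d (A : set 'rV[R]_d) : (0 <= lebesgue_rV A)%E.
Proof. by have [m ->] := lebesgue_rV_sfm d; exact: measure_ge0. Qed.

Let lebesgue_rV_sigma_additive d :
  semi_sigma_additive (@lebesgue_rV d).
Proof.
by have [m ->] := lebesgue_rV_sfm d; exact: measure_semi_sigma_additive.
Qed.

HB.instance Definition _ d := isMeasure.Build _ _ _ (@lebesgue_rV d)
  (@lebesgue_rV0 d) (@lebesgue_rV_ge0 d) (@lebesgue_rV_sigma_additive d).

Let lebesgue_rV_sigma_finite d : sigma_finite setT (@lebesgue_rV d).
Proof. by have [m ->] := lebesgue_rV_sfm d; exact: sigma_finiteT. Qed.

HB.instance Definition _ d := Measure_isSigmaFinite.Build _ _ _
  (@lebesgue_rV d) (@lebesgue_rV_sigma_finite d).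

End lebesgue_rV.

Section domain.
Context (R : realType) (d : nat).
Implicit Types (Omega : set 'rV[R]_d).

(* Near each boundary point, Omega is, in suitable orthonormal coordinates
   x *m Q, the region strictly above the graph of a Lipschitz function gamma;
   coordinate i is the vertical one and col' i deletes it. *)
Definition lipschitz_boundary Omega :=
  forall x0, (closure Omega `\` interior Omega) x0 ->
  exists (Q : 'M[R]_d) (i : 'I_d) (gamma : 'rV[R]_d.-1 -> R) (L : R),
    [/\ Q *m Q^T = 1%:M,
        L.-lipschitz gamma &
        \forall x \near x0,
          Omega x <-> gamma (col' i (x *m Q)) < (x *m Q) 0 i].

End domain.

Section function_spaces.
Context (R : realType) (d : nat) (Omega : set 'rV[R]_d).
Local Notation leb := (@lebesgue_rV R d).
Implicit Types (u v f : 'rV[R]_d -> R).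

(* Elements of L^2(Omega) are represented by functions on R^d, of which only
   the values in Omega matter. *)
Definition L2 u :=
  measurable_fun Omega u /\ leb.-integrable Omega (fun x => (u x ^+ 2)%:E).

Definition inner u v : R := \int[leb]_(x in Omega) (u x * v x).

Definition L2cvg (u_ : nat -> 'rV[R]_d -> R) u :=
  (\int[leb]_(x in Omega) ((u_ n x - u x) ^+ 2)%:E)%E @[n --> \oo] --> 0%E.

Definition orthonormal_basis (phi : nat -> 'rV[R]_d -> R) :=
  [/\ forall k, L2 (phi k),
      forall j k, inner (phi j) (phi k) = (j == k)%:R &
      forall u, L2 u ->
        L2cvg (fun n x => \sum_(k < n) inner u (phi k) * phi k x) u].

Definition partial (i : 'I_d) f : 'rV[R]_d -> R :=
  fun x => 'D_(delta_mx 0 i) f x.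

Definition smooth f :=
  forall s : seq 'I_d, let g := foldr partial f s in
    continuous g /\ forall i x, derivable g x (delta_mx 0 i).

Definition test_function f :=
  let supp := closure [set x | f x != 0] in
  [/\ smooth f, compact supp & supp `<=` Omega].

(* u belongs to H^1_0(Omega), the H^1-closure of the test functions, and g is
   its weak gradient. *)
Definition H10 u (g : 'I_d -> 'rV[R]_d -> R) :=
  [/\ L2 u, forall i, L2 (g i) &
      exists psi : nat -> 'rV[R]_d -> R,
        [/\ forall n, test_function (psi n),
            L2cvg psi u &
            forall i, L2cvg (fun n => partial i (psi n)) (g i)]].

(* - Delta u = lambda u in Omega, u = 0 on the boundary, in the weak sense. *)
Definition dirichlet_eigenfunction (lambda : R) u :=
  exists2 g, H10 u g &
    forall v, test_function v ->
      \sum_(i < d) inner (g i) (partial i v) = lambda * inner u v.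

End function_spaces.

Section dotted_spaces.
Context (R : realType) (d : nat) (Omega : set 'rV[R]_d).
Context (lam : nat -> R) (phi : nat -> 'rV[R]_d -> R).
Implicit Types (s t : R) (u v : 'rV[R]_d -> R).
Implicit Types (F : ('rV[R]_d -> R) -> R).

Definition dot_norm s u : \bar R :=
  sqrte (\sum_(0 <= k <oo) (lam k `^ s * inner Omega u (phi k) ^+ 2)%:E)%E.

Definition dot_space s u := L2 Omega u /\ (dot_norm s u < +oo)%E.

(* A bounded linear functional on dot_space s is given by a function F on all
   of 'rV[R]_d -> R, of which only the values on dot_space s matter. *)
Definition dual_space s F :=
  (forall (a : R) u v, dot_space s u -> dot_space s v ->
     F (fun x => a * u x + v x) = a * F u + F v) /\
  exists C : R, forall u, dot_space s u -> (`|F u|%:E <= C%:E * dot_norm s u)%E.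

Definition dual_norm s F : \bar R :=
  sqrte (\sum_(0 <= k <oo) (lam k `^ (- s) * F (phi k) ^+ 2)%:E)%E.

(* The sequence U of elements of L^2(Omega) converges in the norm of the space
   of order t: a space of functions if 0 <= t, the dual of the space of order
   - t otherwise, in which u stands for the functional inner Omega u. *)
Definition cvg_in_dot_space t (U : nat -> 'rV[R]_d -> R) : Prop :=
  if 0 <= t then
    exists2 u, dot_space t u &
      dot_norm t (fun x => U n x - u x) @[n --> \oo] --> 0%E
  else
    exists2 F, dual_space (- t) F &
      dual_norm (- t) (fun v => inner Omega (U n) v - F v) @[n --> \oo] --> 0%E.

End dotted_spaces.

Section probability.
Context d (Xi : measurableType d) (R : realType) (P : probability Xi R).

Definition independent_RVs (w : nat -> {RV P >-> R}) :=
  forall (s : seq nat) (B : nat -> set R),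
    uniq s -> (forall k, measurable (B k)) ->
    P (\bigcap_(k in [set` s]) (w k @^-1` B k)) =
    (\prod_(k <- s) P (w k @^-1` B k))%E.

End probability.

(* The index k stands for k + 1: lam 0 and phi 0 are the first eigenpair. *)
Definition Phi_ (R : realType) (d : nat) (lam : nat -> R)
    (phi : nat -> 'rV[R]_d -> R) (tau : R) (Xi : Type) (w : nat -> Xi -> R)
    (n : nat) (xi : Xi) : 'rV[R]_d -> R :=
  fun x => tau * \sum_(k < n) (1 + lam k) `^ (- 2^-1) * w k xi * phi k x.

(* Main.v *)
Require Import Defs.
From mathcomp Require Import all_boot all_order all_algebra.
From mathcomp Require Import all_classical all_reals all_analysis.
From mathcomp Require Import measurable_realfun.
From mathcomp Require Import ring lra.

(** Write t = 1 - d/2 - eps and let a_k be the coefficient of phi_k in the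
    expansion of the random map, so that
    [lam k `^ t * a_k ^+ 2 = tau ^+ 2 * (lam k `^ t / (1 + lam k)) * w_k ^+ 2].

    Since E(w_k^2) = 1, the expectation of the sum of these terms is tau^2
    times the sum of lam_k^t / (1 + lam_k).  The last ratio is at most
    lam_k^(-d/2 - eps), which the lower Weyl bound compares with
    k^(-1 - 2 eps/d): the expectation is finite ([weyl_series_fin]), so the sum
    itself is finite almost surely ([ae_weighted_sqr_series_fin]).

    What remains is deterministic: if the sum of lam_k^t a_k^2 is finite, then
    the partial sums of the a_k phi_k converge in the space of order t, because
    the squared distance to the limit is a tail of that sum.  The limit itself
    has to be produced, in one of two ways according to the sign of t.
    For 0 <= t the coefficients are square summable and the limit is a function
    given by the Riesz-Fischer theorem ([riesz_fischer]), which rests on the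
    completeness of L^2 ([L2_complete]).  For t < 0 the limit is the functional
    sending u to the sum of the a_k <u, phi_k>; this series converges absolutely
    and is bounded by the Cauchy-Schwarz inequality with the weights lam_k^t
    and lam_k^(-t) ([cvg_in_dot_space_lt0]). *)

Import Order.TTheory GRing.Theory Num.Theory.
Import numFieldNormedType.Exports.
Local Open Scope classical_set_scope.
Local Open Scope ring_scope.
Set Implicit Arguments.
Unset Strict Implicit.

(** * Numerical series *)

(** The terms of exponent 1 + p are dominated by the increments of x^(-p).
    With y = x + 1, the bound ln (x / y) = ln (1 - 1/y) <= - 1/y gives
    x^(-p) >= y^(-p) exp (p / y) >= y^(-p) (1 + p / y). *)
Lemma powR_telescope (R : realType) (p x : R) : 0 < p -> 0 < x ->
  p * ((x + 1) `^ (1 + p))^-1 <= (x `^ p)^-1 - ((x + 1) `^ p)^-1.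
Proof.
move=> p0 x0; set y := x + 1.
have y0 : 0 < y by rewrite addr_gt0.
have yn : y != 0 by rewrite gt_eqF.
have lnxy : ln x <= ln y - y^-1.
  have -> : x = y * (1 + - y^-1) by rewrite mulrDr mulrN mulfV// mulr1 /y addrK.
  have y1 : y^-1 < 1 by rewrite invf_lt1// /y ltrDr.
  rewrite lnM ?posrE// ?subr_gt0// lerD2l le_ln1Dx// ltrN2//.
rewrite powRD ?yn ?implybT// powRr1 ?(ltW y0)// -!powRN.
have -> : (y * y `^ p)^-1 = y^-1 * y `^ (- p) by rewrite invfM powRN.
have : y `^ (- p) * (1 + p * y^-1) <= x `^ (- p).
  apply: (@le_trans _ _ (y `^ (- p) * expR (p * y^-1))).
    by rewrite ler_wpM2l ?powR_ge0// expR_ge1Dx.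
  rewrite /powR !gt_eqF// -expRD ler_expR.
  have := ler_wpM2l (ltW p0) lnxy; rewrite mulrBr !mulNr; lra.
set a := y `^ _; set b := x `^ _; rewrite mulrDr; lra.
Qed.

Lemma riemannR_series_bounded (R : realType) (p : R) : 0 < p ->
  (\sum_(0 <= k <oo) (riemannR (1 + p) k)%:E < +oo)%E.
Proof.
move=> p0.
have H n : \sum_(0 <= k < n) riemannR (1 + p) k <= 1 + p^-1.
  case: n => [|n]; first by rewrite big_geq// addr_ge0// invr_ge0 ltW.
  have r0 q : riemannR q 0 = 1 :> R by rewrite /riemannR mulr1n powR1 invr1.
  rewrite big_nat_recl// r0 lerD2l.
  apply: (@le_trans _ _
      (\sum_(0 <= i < n) p^-1 * (riemannR p i - riemannR p i.+1))).
    apply: ler_sum => i _; rewrite ler_pdivlMl//.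
    by have := powR_telescope p0 (ltr0Sn R i); rewrite natr1.
  rewrite -mulr_sumr -[leRHS]mulr1 ler_wpM2l ?invr_ge0 ?(ltW p0)//.
  rewrite (telescope_sumr_eq (fun i => - riemannR p i))//; last first.
    by move=> i _; rewrite opprK addrC.
  rewrite r0 opprK addrC gerBl.
  by rewrite invr_ge0 powR_ge0.
apply: (@le_lt_trans _ _ (1 + p^-1)%:E); last exact: ltry.
apply: lime_le.
  apply: is_cvg_nneseries => n _ _.
  by rewrite lee_fin ltW// riemannR_gt0// addr_ge0// ltW.
by apply: nearW => n; rewrite sumEFin lee_fin.
Qed.

Lemma nneseries_lty_cvg (R : realType) (f : nat -> R) : (forall k, 0 <= f k) ->
  (\sum_(0 <= k <oo) (f k)%:E < +oo)%E -> cvgn (series f).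
Proof.
move=> f0 foo; apply: nondecreasing_is_cvgn.
  by apply: nondecreasing_series => k _ _.
exists (fine (\sum_(0 <= k <oo) (f k)%:E)%E) => _ [n _ <-].
rewrite -lee_fin fineK; last first.
  by rewrite ge0_fin_numE//; apply: nneseries_ge0 => k _ _; rewrite lee_fin.
rewrite /series/= -sumEFin; apply: nneseries_lim_ge => k _ _.
by rewrite lee_fin.
Qed.

Lemma nneseries_sqr_lty (R : realType) (a g : nat -> R) (c : R) : 0 < c ->
  (forall k, c <= g k) ->
  (\sum_(0 <= k <oo) (g k * a k ^+ 2)%:E < +oo)%E ->
  (\sum_(0 <= k <oo) (a k ^+ 2)%:E < +oo)%E.
Proof.
move=> c0 cg goo.
apply: (@le_lt_trans _ _ (\sum_(0 <= k <oo) (c^-1%:E * (g k * a k ^+ 2)%:E))%E).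
  apply: lee_nneseries => k _; first by rewrite lee_fin sqr_ge0.
  by rewrite -EFinM lee_fin mulrA ler_peMl ?sqr_ge0// mulrC ler_pdivlMr// mul1r.
rewrite nneseriesZl; last first.
  by move=> k _; rewrite lee_fin mulr_ge0 ?sqr_ge0// (le_trans _ (cg k))// ltW.
rewrite lte_mul_pinfty// ?lee_fin ?invr_ge0 ?ltW//.
Qed.

Lemma sqrte_cvg0 (R : realType) (u : nat -> \bar R) : (forall n, 0 <= u n)%E ->
  u n @[n --> \oo] --> 0%E -> sqrte (u n) @[n --> \oo] --> 0%E.
Proof.
move=> u0 /fine_cvgP[uf uc]; apply/fine_cvgP; split.
  by near=> n; rewrite sqrte_fin_num//; near: n.
have : Num.sqrt (fine (u n)) @[n --> \oo] --> Num.sqrt (0 : R).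
  exact: (cvg_comp _ _ uc (@sqrt_continuous R 0)).
rewrite sqrtr0; apply: cvg_trans; apply: near_eq_cvg.
by apply: nearW => n /=; case: (u n) => [r||]; rewrite /= ?sqrtr0.
Unshelve. all: by end_near.
Qed.

(** The form in which the tails occur below: the terms before [n] are set to 0,
    and the summation always starts at 0. *)
Lemma sqrte_tail_cvg0 (R : realType) (b : nat -> R) : (forall k, 0 <= b k) ->
  (\sum_(0 <= k <oo) (b k)%:E < +oo)%E ->
  sqrte (\sum_(0 <= k <oo) (b k *+ (n <= k))%:E)%E @[n --> \oo] --> 0%E.
Proof.
move=> b0 boo; apply: sqrte_cvg0.
  by move=> n; apply: nneseries_ge0 => k _ _; rewrite lee_fin mulrn_wge0.
have := nneseries_tail_cvg boo (fun k _ => b0 k : (0 <= (b k)%:E)%E).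
apply: cvg_trans; apply: near_eq_cvg; apply: nearW => n.
rewrite (@nneseries_split _ _ 0 n) ?add0n; last first.
  by move=> k _; rewrite lee_fin mulrn_wge0.
rewrite big_nat big1 ?add0e; last first.
  by move=> k /andP[_ kn]; rewrite leqNgt kn.
apply/congr_lim/funext => m; apply: eq_big_nat => k /andP[nk _].
by rewrite nk.
Qed.

Lemma sum_CauchySchwarz (R : realType) n (x y : nat -> R) :
  (\sum_(k < n) x k * y k) ^+ 2 <=
  (\sum_(k < n) x k ^+ 2) * (\sum_(k < n) y k ^+ 2).
Proof.
elim: n => [|n IH]; first by rewrite !big_ord0 expr0n mulr0.
rewrite !big_ord_recr/=; move: IH.
set S := \sum_(i < n) (x i * y i); set A := \sum_(i < n) x i ^+ 2.
set B := \sum_(i < n) y i ^+ 2; move: (x n) (y n) => a b IH.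
have A0 : 0 <= A by apply: sumr_ge0 => i _; exact: sqr_ge0.
have B0 : 0 <= B by apply: sumr_ge0 => i _; exact: sqr_ge0.
have Q0 : 0 <= A * b ^+ 2 + B * a ^+ 2 by rewrite addr_ge0// mulr_ge0// sqr_ge0.
(* The geometric mean of the two terms on the right is at least |S a b|. *)
have : 2 * S * (a * b) <= A * b ^+ 2 + B * a ^+ 2.
  apply: le_trans (ler_norm _) _; rewrite -(ger0_norm Q0) -ler_sqr ?nnegrE//.
  rewrite !real_normK ?num_real//.
  have := ler_wpM2r (sqr_ge0 (a * b)) IH.
  have := sqr_ge0 (A * b ^+ 2 - B * a ^+ 2).
  nra.
nra.
Qed.

(** * Completeness of L^2 *)

Section L2_complete.
Context (R : realType) (disp : measure_display) (T : measurableType disp).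
Context (m : {measure set T -> \bar R}) (D : set T) (mD : measurable D).

Lemma measurable_sqr_sub (f g : T -> R) : measurable_fun D f ->
  measurable_fun D g -> measurable_fun D (fun x => ((f x - g x) ^+ 2)%:E).
Proof.
move=> mf mg; apply/measurable_EFinP; apply: measurable_funX.
exact: measurable_funB.
Qed.

(** A pointwise criterion that sees only squares of increments, hence can be
    integrated without the triangle inequality in L^2: by the inequality of the
    arithmetic and geometric means, each increment is at most
    2^j (v_(j+1) - v_j)^2 + 2^(-j), so the increments are absolutely
    summable. *)
Lemma cvg_of_weighted_sqr (v : nat -> R) :
  (\sum_(0 <= j <oo) (2 ^+ j * (v j.+1 - v j) ^+ 2)%:E < +oo)%E ->
  cvgn v.
Proof.
move=> G.
have c1 : cvgn (series (fun j => 2 ^+ j * (v j.+1 - v j) ^+ 2)).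
  by apply: nneseries_lty_cvg G => j; rewrite mulr_ge0 ?sqr_ge0// exprn_ge0.
have c2 : cvgn (series (geometric 1 (2^-1 : R))).
  apply: is_cvg_geometric_series.
  by rewrite ger0_norm ?invr_ge0// invf_lt1// ltr1n.
have c3 : cvgn [normed series (fun j => v j.+1 - v j)].
  apply: (series_le_cvg _ _ _ (is_cvg_seriesD c1 c2)) => j //=.
    by apply: addr_ge0; rewrite mulr_ge0 ?sqr_ge0 ?exprn_ge0 ?invr_ge0.
  have t0 : 0 < (2 ^+ j : R) by rewrite exprn_gt0.
  rewrite [leRHS](_ : _ = 2 ^+ j * (v j.+1 - v j) ^+ 2 + (2 ^+ j)^-1);
    last first.
    by rewrite -exprVn -[X in _ = _ + X]mul1r.
  rewrite -[in leRHS](real_normK (num_real (v j.+1 - v j))).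
  set t := 2 ^+ j in t0 *; set y := `|_|.
  have y0 : 0 <= y by exact: normr_ge0.
  rewrite -(ler_pM2r t0) mulrDl mulVf ?gt_eqF//.
  have := sqr_ge0 (t * y - 1); have : 0 <= t * y by rewrite mulr_ge0// ltW.
  nra.
have /cvg_ex[l /= cl] := normed_cvg c3.
apply/cvg_ex; exists (l + v 0%N).
apply: (cvg_trans _ (cvgD cl (cvg_cst (v 0%N)))).
apply: near_eq_cvg; apply: nearW => n.
rewrite [RHS](_ : _ = \sum_(0 <= j < n) (v j.+1 - v j) + v 0%N)//.
by rewrite telescope_sumr// subrK.
Qed.

(** Along a subsequence V whose successive squared distances are at most
    4^(-j), the series G of the 2^j (V_(j+1) - V_j)^2 has a finite integral.
    So G is finite almost everywhere, and there V converges to some u by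
    [cvg_of_weighted_sqr].  Fatou's lemma then bounds the distance from U_n to
    u by the distances from U_n to the V_i. *)
Theorem L2_complete (U : nat -> T -> R) :
  (forall n, measurable_fun D (U n)) ->
  (forall e : R, 0 < e -> exists N, forall n p, (N <= n)%N -> (N <= p)%N ->
     (\int[m]_(x in D) ((U n x - U p x) ^+ 2)%:E <= e%:E)%E) ->
  exists2 u : T -> R, measurable_fun D u &
    (\int[m]_(x in D) ((U n x - u x) ^+ 2)%:E)%E @[n --> \oo] --> 0%E.
Proof.
move=> mU hC.
have t0 j : 0 < (2 ^+ j : R) by rewrite exprn_gt0.
have /(_ _)/cid-/all_sig[N NP] : forall j, exists N, forall n p, (N <= n)%N ->
    (N <= p)%N ->
    (\int[m]_(x in D) ((U n x - U p x) ^+ 2)%:E <=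
     ((2 ^+ j * 2 ^+ j)^-1)%:E)%E.
  by move=> j; apply: hC; rewrite invr_gt0 mulr_gt0.
(* The sum makes [k j] at least every [N i] with [i <= j]; the summand [j] makes
   it unbounded even if [N] is not. *)
pose k j := (j + \sum_(i < j.+1) N i)%N.
have Nk i j : (i <= j)%N -> (N i <= k j)%N.
  move=> ij; rewrite /k (bigD1 (Ordinal (ij : (i < j.+1)%N)))//=.
  by rewrite addnCA leq_addr.
pose V j := U (k j).
have sq0 j x : (0 <= (2 ^+ j * (V j.+1 x - V j x) ^+ 2)%:E)%E.
  by rewrite lee_fin mulr_ge0 ?sqr_ge0// ltW.
have mV j : measurable_fun D (fun x => (2 ^+ j * (V j.+1 x - V j x) ^+ 2)%:E).
  apply/measurable_EFinP; apply: measurable_funM => //.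
  by apply: measurable_funX; apply: measurable_funB; exact: mU.
pose G x := (\sum_(0 <= j <oo) (2 ^+ j * (V j.+1 x - V j x) ^+ 2)%:E)%E.
have G0 x : (0 <= G x)%E by apply: nneseries_ge0.
have mG : measurable_fun D G.
  by apply: ge0_emeasurable_sum => // j x _ _; exact: sq0.
have iG : m.-integrable D G.
  apply/integrableP; split=> //; under eq_integral do rewrite gee0_abs//.
  rewrite integral_nneseries//.
  (* The j-th integral is at most 2^j 4^(-j) = 2^(-j). *)
  apply: (@le_lt_trans _ _ (\sum_(0 <= j <oo) (2 / (2 ^ (j + 1))%:R)%:E)%E).
    apply: lee_nneseries => [j _ _|j _]; first exact: integral_ge0.
    under eq_integral do rewrite EFinM.
    rewrite ge0_integralZl_EFin//; [|by move=> x _; rewrite lee_fin sqr_ge0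
                                |by apply: measurable_sqr_sub; exact: mU].
    apply: (@le_trans _ _ ((2 ^+ j)%:E * ((2 ^+ j * 2 ^+ j)^-1)%:E)%E).
      by rewrite lee_pmul2l ?lte_fin//; apply: NP; apply: Nk.
    rewrite -EFinM lee_fin invfM mulrA divff ?gt_eqF// mul1r addn1 natrX exprS.
    by rewrite invfM mulrA divff// mul1r.
  rewrite (_ : limn _ = (2 / 2 ^+ 0)%:E) ?ltry//.
  by apply: cvg_lim => //; exact: cvg_geometric_eseries_half.
have cG : {ae m, forall x, D x -> cvgn (fun j => V j x)}.
  apply: filterS (integrable_ae mD iG) => x /[apply] Gx.
  by apply: cvg_of_weighted_sqr; rewrite -/(G x) -ge0_fin_numE.
(* An upper limit is measurable without any assumption of convergence, and it
   is the limit wherever there is one. *)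
pose u x := fine (limn_esup (fun j => (V j x)%:E)).
have mu : measurable_fun D u.
  apply: (@measurableT_comp _ _ _ _ _ _ fine); first exact: fine_measurable.
  apply: measurable_fun_limn_esup => j; apply/measurable_EFinP; exact: mU.
have uE x : cvgn (fun j => V j x) -> V j x @[j --> \oo] --> u x.
  move=> cV; rewrite /u.
  have /cvg_limn_einf_sup[_ ->] :
      (V j x)%:E @[j --> \oo] --> (limn (fun j => V j x))%:E.
    by apply: cvg_EFin; [exact: nearW|].
  exact: cV.
exists u => //.
have bnd (e : R) M : (forall n p, (M <= n)%N -> (M <= p)%N ->
      (\int[m]_(x in D) ((U n x - U p x) ^+ 2)%:E <= e%:E)%E) ->
    forall n, (M <= n)%N ->
      (\int[m]_(x in D) ((U n x - u x) ^+ 2)%:E <= e%:E)%E.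
  move=> Me n Mn.
  have mUV i : measurable_fun D (fun x => ((U n x - V i x) ^+ 2)%:E).
    by apply: measurable_sqr_sub; exact: mU.
  have fE : ae_eq m D (fun x => ((U n x - u x) ^+ 2)%:E)
                 (fun x => limn_einf (fun i => ((U n x - V i x) ^+ 2)%:E)).
    apply: filterS cG => x /[apply] /uE cx.
    apply/esym; apply: (cvg_limn_einf_sup _).1.
    apply: cvg_EFin; first exact: nearW.
    by apply: cvgM; apply: cvgB => //; exact: cvg_cst.
  have mE : measurable_fun D
      (fun x => limn_einf (fun i => ((U n x - V i x) ^+ 2)%:E)).
    rewrite (_ : (fun x => _) = fun x =>
        (- limn_esup (fun i => - ((U n x - V i x) ^+ 2)%:E)%E)%E); last first.
      apply/funext => x; rewrite -limn_einfN; congr limn_einf.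
      by apply/funext => i; rewrite /comp oppeK.
    apply: measurableT_comp; first exact: oppe_measurable.
    by apply: measurable_fun_limn_esup => i; apply: measurableT_comp.
  have E0 x : D x -> (0 <= limn_einf (fun i => ((U n x - V i x) ^+ 2)%:E))%E.
    move=> _; rewrite limn_einf_lim; apply: lime_ge; first exact: is_cvg_einfs.
    apply: nearW => i; apply: le_ereal_inf_tmp => _ [l _ <-].
    by rewrite lee_fin sqr_ge0.
  rewrite (ge0_ae_eq_integral mD _ mE _ E0 fE); last 2 first.
  - exact: measurable_sqr_sub.
  - by move=> x _; rewrite lee_fin sqr_ge0.
  apply: (le_trans (fatou _ mD mUV _)).
    by move=> i x _; rewrite lee_fin sqr_ge0.
  rewrite limn_einf_lim; apply: lime_le; first exact: is_cvg_einfs.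
  near=> i; apply: (@le_trans _ _
      (\int[m]_(x in D) ((U n x - V i x) ^+ 2)%:E)%E).
    by apply: ereal_inf_lbound; exists i => /=.
  apply: Me => //; apply: (@leq_trans i); last exact: leq_addr.
  by near: i; exact: nbhs_infty_ge.
apply/fine_cvgP; split.
  have [M /bnd Me] := hC 1 ltr01.
  near=> n; rewrite ge0_fin_numE; last first.
    by apply: integral_ge0 => x _; rewrite lee_fin sqr_ge0.
  apply: (le_lt_trans (Me n _)); last exact: ltry.
  by near: n; exact: nbhs_infty_ge.
apply/cvgrPdist_le => e e0; have [M /bnd Me] := hC e e0.
near=> n; rewrite sub0r normrN /=.
have I0 : (0 <= \int[m]_(x in D) ((U n x - u x) ^+ 2)%:E)%E.
  by apply: integral_ge0 => x _; rewrite lee_fin sqr_ge0.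
have Ie : (\int[m]_(x in D) ((U n x - u x) ^+ 2)%:E <= e%:E)%E.
  by apply: Me; near: n; exact: nbhs_infty_ge.
rewrite ger0_norm ?fine_ge0// -lee_fin fineK// ge0_fin_numE//.
exact: le_lt_trans Ie (ltry _).
Unshelve. all: by end_near.
Qed.

End L2_complete.

(** * Square-integrable functions on an open set *)

(** The sigma-algebra is generated by the coordinates, so openness enters
    through a countable base: an open set is the union of the boxes with
    rational centre and radius 1/(n+1) that it contains. *)
Lemma open_measurable_rV (R : realType) (d : nat) (U : set 'rV[R]_d) :
  open U -> measurable U.
Proof.
move=> oU.
pose B (p : 'rV[rat]_d * nat) : set 'rV[R]_d :=
  [set x | forall i, `|x 0 i - ratr (p.1 0 i)| < p.2.+1%:R^-1].
have mB p : measurable (B p).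
  have -> : B p = \bigcap_(i in [set: 'I_d])
      ((fun v : 'rV[R]_d => v 0 i) @^-1`
         ball (ratr (p.1 0 i) : R) p.2.+1%:R^-1).
    apply/seteqP; split => x Bx i => [_|].
      by rewrite /= /ball /= distrC; exact: Bx.
    by have := Bx i I; rewrite /= /ball /= distrC.
  apply: fin_bigcap_measurable => // i _.
  rewrite -[X in measurable X]setTI; apply: measurable_coord => //.
  by apply: open_measurable; apply: ball_open; rewrite invr_gt0.
have -> : U = \bigcup_(p in [set p | B p `<=` U]) B p.
  apply/seteqP; split => [x Ux|x [p pU] /pU//].
  have /nbhs_ballP[e /= e0 eU] : nbhs x U by exact: open_nbhs_nbhs.
  (* A box of radius r around a point within r of x stays within 2r of x. *)
  pose n := Num.truncn (e^-1 * 2).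
  have ne : n.+1%:R^-1 * 2 < e :> R.
    rewrite mulrC ltr_pdivrMr// mulrC -ltr_pdivrMr// mulrC.
    exact: truncnS_gt.
  have n0 : 0 < n.+1%:R^-1 :> R by rewrite invr_gt0.
  set r := n.+1%:R^-1 in ne n0.
  have /(_ _)/cid-/all_sig[q qP] : forall i : 'I_d, exists q : rat,
      `|x 0 i - ratr q| < r.
    move=> i; have [|q] := @rat_in_itvoo R (x 0 i - r) (x 0 i + r).
      by lra.
    rewrite in_itv/= => q2; exists q; rewrite ltr_norml; lra.
  exists ((\row_i q i), n) => /= [y By|i]; last by rewrite mxE; exact: qP.
  apply: eU; split=> // i j; rewrite (ord1 i) /ball/=.
  have := By j; have := qP j; rewrite mxE /= => a b.
  apply: lt_trans ne; rewrite mulr_natr mulr2n.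
  apply: le_lt_trans (ltrD a b).
  by rewrite (distrC (y 0 j)); exact: ler_distD.
rewrite bigcup_mkcond; apply: countable_bigcupT_measurable => [|p].
  exact: countableP.
by case: ifP.
Qed.

Section square_integrable.
Context (R : realType) (d : nat) (Omega : set 'rV[R]_d).
Context (mO : measurable Omega).
Local Notation leb := (@lebesgue_rV R d).
Implicit Types u v f g : 'rV[R]_d -> R.

Lemma L2_integrable_mul u v : L2 Omega u -> L2 Omega v ->
  leb.-integrable Omega (EFin \o (fun x => u x * v x)).
Proof.
move=> [mu iu] [mv iv].
apply: (@le_integrable _ _ _ _ _ mO _
  (fun x => (u x ^+ 2)%:E + (v x ^+ 2)%:E)%E).
- by apply/measurable_EFinP; exact: measurable_funM.
- move=> x _; rewrite [X in (_ <= `|X|)%E]/= -EFinD !abse_EFin lee_fin normrM.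
  rewrite [leRHS]ger0_norm ?addr_ge0 ?sqr_ge0//.
  rewrite -(real_normK (num_real (u x))) -(real_normK (num_real (v x))).
  have := sqr_ge0 (`|u x| - `|v x|); have := normr_ge0 (u x).
  have := normr_ge0 (v x); nra.
- exact: integrableD.
Qed.

Lemma innerC u v : inner Omega u v = inner Omega v u.
Proof. by rewrite /inner; under eq_Rintegral do rewrite mulrC. Qed.

Lemma L2_lin (a : R) u v : L2 Omega u -> L2 Omega v ->
  L2 Omega (fun x => a * u x + v x).
Proof.
move=> Lu Lv; split.
  apply: measurable_funD; last by case: Lv.
  by apply: measurable_funM => //; case: Lu.
have iuv := L2_integrable_mul Lu Lv.
rewrite [X in integrable _ _ X](_ : _ = (fun x => ((a ^+ 2)%:E * (u x ^+ 2)%:E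
   + (2 * a)%:E * (u x * v x)%:E) + (v x ^+ 2)%:E)%E); last first.
  by apply/funext => x; rewrite -!EFinM -!EFinD; congr EFin; ring.
apply: integrableD => //; last by case: Lv.
by apply: integrableD => //; apply: integrableZl => //; case: Lu.
Qed.

Lemma L20 : L2 Omega (fun=> 0).
Proof.
split; first exact: measurable_cst.
by under eq_fun do rewrite expr0n; exact: integrable0.
Qed.

Lemma L2_sum n (a : nat -> R) (f : nat -> 'rV[R]_d -> R) :
  (forall k, L2 Omega (f k)) -> L2 Omega (fun x => \sum_(k < n) a k * f k x).
Proof.
move=> Lf; elim: n => [|n IH].
  by under eq_fun do rewrite big_ord0; exact: L20.
by under eq_fun do rewrite big_ord_recr/= addrC; exact: L2_lin.
Qed.

Lemma L2B u v : L2 Omega u -> L2 Omega v -> L2 Omega (fun x => u x - v x).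
Proof.
move=> Lu Lv; under eq_fun do rewrite addrC -mulN1r.
exact: L2_lin.
Qed.

Lemma inner_lin (a : R) u v f : L2 Omega u -> L2 Omega v -> L2 Omega f ->
  inner Omega (fun x => a * u x + v x) f =
  a * inner Omega u f + inner Omega v f.
Proof.
move=> Lu Lv Lf; rewrite /inner.
under eq_Rintegral do rewrite mulrDl -mulrA.
rewrite RintegralD//; last exact: L2_integrable_mul.
  by rewrite RintegralZl//; exact: L2_integrable_mul.
by have := integrableZl mO a (L2_integrable_mul Lu Lf).
Qed.

Lemma inner_sum n (a : nat -> R) (f : nat -> 'rV[R]_d -> R) g :
  (forall k, L2 Omega (f k)) -> L2 Omega g ->
  inner Omega (fun x => \sum_(k < n) a k * f k x) g =
  \sum_(k < n) a k * inner Omega (f k) g.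
Proof.
move=> Lf Lg; elim: n => [|n IH].
  rewrite big_ord0 /inner; under eq_Rintegral do rewrite big_ord0 mul0r.
  by rewrite Rintegral_cst// mul0r.
rewrite big_ord_recr/= -IH addrC -inner_lin//; last exact: L2_sum.
by rewrite /inner; under eq_Rintegral do rewrite big_ord_recr/= addrC.
Qed.

Lemma innerB u v f : L2 Omega u -> L2 Omega v -> L2 Omega f ->
  inner Omega (fun x => u x - v x) f = inner Omega u f - inner Omega v f.
Proof.
move=> Lu Lv Lf; rewrite addrC -mulN1r -inner_lin// /inner.
by under eq_Rintegral do rewrite addrC -mulN1r.
Qed.

Lemma inner_ge0 u : 0 <= inner Omega u u.
Proof. by apply: Rintegral_ge0 => x _; rewrite -expr2 sqr_ge0. Qed.

Lemma integral_sqrE u : L2 Omega u ->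
  (\int[leb]_(x in Omega) (u x ^+ 2)%:E)%E = (inner Omega u u)%:E.
Proof.
move=> Lu; rewrite /inner /Rintegral fineK; last first.
  by apply: integrable_fin_num => //; exact: L2_integrable_mul.
by apply: eq_integral => x _; rewrite expr2.
Qed.

(** One-term Bessel inequality: expand the square of the distance from [u] to
    its projection on [f]. *)
Lemma bessel_one u f : L2 Omega u -> L2 Omega f -> inner Omega f f = 1 ->
  inner Omega u f ^+ 2 <= inner Omega u u.
Proof.
move=> Lu Lf f1; set c := inner Omega u f.
have Lw := L2_lin (- c) Lf Lu.
have := inner_ge0 (fun x => - c * f x + u x).
rewrite inner_lin// [inner _ f _]innerC [inner _ u _]innerC !inner_lin//.
by rewrite f1 [inner Omega f u]innerC -/c; nra.
Qed.

End square_integrable.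

(** * Orthonormal expansions *)

Section fourier.
Context (R : realType) (d : nat) (Omega : set 'rV[R]_d).
Context (mO : measurable Omega) (phi : nat -> 'rV[R]_d -> R).
Context (Lphi : forall k, L2 Omega (phi k)).
Context (ophi : forall j k, inner Omega (phi j) (phi k) = (j == k)%:R).
Local Notation leb := (@lebesgue_rV R d).
Implicit Types (a : nat -> R) (u : 'rV[R]_d -> R).

Definition partial_sum a n : 'rV[R]_d -> R :=
  fun x => \sum_(k < n) a k * phi k x.

Lemma L2_partial_sum a n : L2 Omega (partial_sum a n).
Proof. exact: L2_sum. Qed.

Lemma sum_orthonormal a n k :
  \sum_(j < n) a j * inner Omega (phi j) (phi k) = a k *+ (k < n).
Proof.
under eq_bigr do rewrite ophi.
case: ltnP => kn; last first.
  apply: big1 => j _; rewrite lt_eqF ?mulr0//.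
  exact: leq_trans (ltn_ord j) kn.
rewrite (bigD1 (Ordinal kn))//= eqxx mulr1 big1 ?addr0// => j.
by rewrite -val_eqE /= => /negbTE ->; rewrite mulr0.
Qed.

Lemma inner_partial_sum a n k :
  inner Omega (partial_sum a n) (phi k) = a k *+ (k < n).
Proof. by rewrite inner_sum// sum_orthonormal. Qed.

Lemma inner_partial_sum_self a n :
  inner Omega (partial_sum a n) (partial_sum a n) = \sum_(k < n) a k ^+ 2.
Proof.
rewrite inner_sum//; last exact: L2_partial_sum.
apply: eq_bigr => k _; rewrite innerC inner_partial_sum.
by rewrite ltn_ord expr2.
Qed.

(** By Pythagoras the left-hand side is the sum of the a_k^2 over the indices
    between n and p.  Both partial sums are written over a common range, with
    indicator coefficients, which spares a case analysis on the order of n and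
    p. *)
Lemma partial_sumB_sqr_le a N n p : (N <= n)%N -> (N <= p)%N ->
  (\int[leb]_(x in Omega) ((partial_sum a n x - partial_sum a p x) ^+ 2)%:E
    <= \sum_(N <= k <oo) (a k ^+ 2)%:E)%E.
Proof.
move=> Nn Np; pose M := maxn n p.
pose c k := a k * ((k < n)%:R - (k < p)%:R).
have wid q x : (q <= M)%N ->
    partial_sum a q x = \sum_(k < M) a k * (k < q)%:R * phi k x.
  move=> qM; rewrite /partial_sum (big_ord_widen M (fun k => a k * phi k x))//.
  rewrite big_mkcond; apply: eq_bigr => k _.
  by case: ifP; rewrite ?mulr1// mulr0 mul0r.
have E x : partial_sum a n x - partial_sum a p x = partial_sum c M x.
  rewrite (wid n) ?leq_maxl// (wid p) ?leq_maxr// -sumrB.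
  by apply: eq_bigr => k _; rewrite /c mulrBr mulrBl.
under eq_integral do rewrite E.
rewrite integral_sqrE//; last exact: L2_partial_sum.
rewrite inner_partial_sum_self.
apply: (@le_trans _ _ (\sum_(N <= k < M) (a k ^+ 2)%:E)%E).
  rewrite sumEFin lee_fin -(big_mkord xpredT (fun k => c k ^+ 2)).
  rewrite (@big_cat_nat _ _ _ N)//=; last by rewrite leq_max Nn.
  rewrite big_nat big1 ?add0r; last first.
    move=> k /andP[_ kN]; rewrite /c (leq_trans kN Nn) (leq_trans kN Np).
    by rewrite subrr mulr0 expr0n.
  apply: ler_sum => k _; rewrite /c exprMn ler_piMr ?sqr_ge0//.
  by case: (k < n)%N; case: (k < p)%N;
    rewrite ?subrr ?subr0 ?sub0r ?sqrrN ?expr1n ?expr0n.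
by apply: nneseries_lim_ge => k _ _; rewrite lee_fin sqr_ge0.
Qed.

(** The limit exists by completeness.  Its coefficients are those of the partial
    sums because, by [bessel_one], taking a coefficient is continuous for the
    distance of L^2. *)
Lemma riesz_fischer a : (\sum_(0 <= k <oo) (a k ^+ 2)%:E < +oo)%E ->
  exists2 u, L2 Omega u & forall k, inner Omega u (phi k) = a k.
Proof.
move=> aoo.
have sq0 k : (0 <= (a k ^+ 2)%:E)%E by rewrite lee_fin sqr_ge0.
have [n|e e0|u mu cu] := @L2_complete _ _ _ leb _ mO (partial_sum a).
- by case: (L2_partial_sum a n).
- have /fine_cvgP[tf /cvgrPdist_le/(_ e e0)] :=
    nneseries_tail_cvg aoo (fun k _ => sq0 k).
  move=> te.
  have : \forall N \near \oo, (\sum_(N <= k <oo) (a k ^+ 2)%:E <= e%:E)%E.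
    near=> N.
    have Nf : (\sum_(N <= k <oo) (a k ^+ 2)%:E)%E \is a fin_num by near: N.
    rewrite -(fineK Nf) lee_fin; apply: le_trans (ler_norm _) _.
    by rewrite -normrN -sub0r; near: N.
  case=> N _ Ne; exists N => n p Nn Np.
  by apply: le_trans (partial_sumB_sqr_le a Nn Np) _; exact: Ne N (leqnn N).
have mB n : measurable_fun Omega (fun x => ((partial_sum a n x - u x) ^+ 2)%:E).
  by apply: measurable_sqr_sub => //; case: (L2_partial_sum a n).
have LB : \forall n \near \oo, L2 Omega (fun x => partial_sum a n x - u x).
  have /fine_cvgP[cf _] := cu.
  near=> n; split.
    by apply: measurable_funB => //; case: (L2_partial_sum a n).
  apply/integrableP; split; first exact: mB.
  under eq_integral do rewrite gee0_abs ?lee_fin ?sqr_ge0//.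
  rewrite -ge0_fin_numE; first by near: n.
  by apply: integral_ge0 => x _; rewrite lee_fin sqr_ge0.
(* [u] is the difference of a partial sum and of a square-integrable error. *)
have Lu : L2 Omega u.
  have [n _ /(_ n (leqnn n)) Ln] := LB.
  have := L2B mO (L2_partial_sum a n) Ln.
  by under eq_fun do rewrite subKr.
exists u => // k.
apply/eqP; rewrite eq_sym -subr_eq0 -sqrf_eq0 eq_le sqr_ge0 andbT -lee_fin.
apply: (cvge_to_ge cu); near=> n.
have Ln : L2 Omega (fun x => partial_sum a n x - u x) by near: n.
rewrite integral_sqrE// lee_fin; apply: le_trans (bessel_one mO Ln (Lphi k) _).
  rewrite innerB//; last exact: L2_partial_sum.
  rewrite inner_partial_sum (_ : (k < n)%N)//; near: n; exact: nbhs_infty_gt.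
by rewrite ophi eqxx.
Unshelve. all: by end_near.
Qed.

End fourier.

(** * Convergence in the dotted spaces *)

Section dot_space_convergence.
Context (R : realType) (d : nat) (Omega : set 'rV[R]_d).
Context (mO : measurable Omega) (lam : nat -> R).
Context (phi : nat -> 'rV[R]_d -> R) (Lphi : forall k, L2 Omega (phi k)).
Context (ophi : forall j k, inner Omega (phi j) (phi k) = (j == k)%:R).
Context (lam_gt0 : forall k, 0 < lam k).
Context (a : nat -> R).

Let sq0 (g : R) (c : nat -> R) k : (0 <= (lam k `^ g * c k ^+ 2)%:E)%E.
Proof. by rewrite lee_fin mulr_ge0 ?powR_ge0 ?sqr_ge0. Qed.

Let sub_trunc n k : (a k *+ (k < n) - a k) ^+ 2 = a k ^+ 2 *+ (n <= k).
Proof.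
by rewrite ltnNge; case: (n <= k)%N; rewrite /= ?sub0r ?sqrrN// subrr expr0n.
Qed.

(** The lower bound on [lam] makes the weights bounded below, so that the
    coefficients alone are square summable. *)
Lemma cvg_in_dot_space_ge0 (t : R) : (forall k, lam 0%N <= lam k) -> 0 <= t ->
  (\sum_(0 <= k <oo) (lam k `^ t * a k ^+ 2)%:E < +oo)%E ->
  cvg_in_dot_space Omega lam phi t (partial_sum phi a).
Proof.
move=> lam_ge t0 aoo; rewrite /cvg_in_dot_space t0.
have [|u Lu ua] := @riesz_fischer _ _ _ mO phi Lphi ophi a.
  apply: (@nneseries_sqr_lty R a (fun k => lam k `^ t) (lam 0%N `^ t)) => //.
    by rewrite powR_gt0.
  by move=> k; rewrite ge0_ler_powR ?nnegrE// ltW.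
exists u.
  split=> //; rewrite /dot_norm; under eq_eseriesr do rewrite ua.
  move: aoo; rewrite -!ge0_fin_numE ?sqrte_ge0 ?nneseries_ge0// => aoo.
  by rewrite sqrte_fin_num// nneseries_ge0.
have b0 k : 0 <= lam k `^ t * a k ^+ 2 by have := sq0 t a k; rewrite lee_fin.
have := sqrte_tail_cvg0 b0 aoo; apply: cvg_trans; apply: near_eq_cvg.
apply: nearW => n; rewrite /dot_norm; congr sqrte; apply: eq_eseriesr => k _.
rewrite (innerB mO)//; last exact: (L2_partial_sum mO).
by rewrite (inner_partial_sum mO)// ua sub_trunc mulrnAr.
Qed.

Let pair_sum u n := \sum_(k < n) a k * inner Omega u (phi k).

(** The values on u of the partial sums, seen as functionals, converge
    absolutely: |a_k u_k| <= lam_k^(-s) a_k^2 + lam_k^s u_k^2. *)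
Let pair_sum_cvg (s : R) u :
  (\sum_(0 <= k <oo) (lam k `^ (- s) * a k ^+ 2)%:E < +oo)%E ->
  dot_space Omega lam phi s u -> cvgn (pair_sum u).
Proof.
move=> aoo [Lu]; rewrite /dot_norm; set S := (\sum_(0 <= k <oo) _)%E => uoo.
have su k : (0 <= (lam k `^ s * inner Omega u (phi k) ^+ 2)%:E)%E.
  exact: (sq0 _ (fun k => inner Omega u (phi k))).
have S0 : (0 <= S)%E by exact: nneseries_ge0.
have Soo : (S < +oo)%E.
  by rewrite -ge0_fin_numE// -sqrte_fin_num// ge0_fin_numE ?sqrte_ge0.
have c1 := nneseries_lty_cvg (fun k => sq0 (- s) a k) aoo.
have c2 := nneseries_lty_cvg (fun k => su k) Soo.
have c3 : cvgn [normed series (fun k => a k * inner Omega u (phi k))].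
  apply: (series_le_cvg _ _ _ (is_cvg_seriesD c1 c2)) => k.
  - exact: normr_ge0.
  - by apply: addr_ge0; [exact: (sq0 _ a)|exact: su].
  have l0 : 0 < lam k `^ s by rewrite powR_gt0.
  rewrite [leRHS](_ : _ = (lam k `^ s)^-1 * a k ^+ 2 +
    lam k `^ s * inner Omega u (phi k) ^+ 2); last by rewrite -powRN.
  rewrite [leLHS]normrM -(real_normK (num_real (a k))).
  rewrite -[in leRHS](real_normK (num_real (inner Omega u (phi k)))).
  set x := `|a k|; set y := `|_|; set l := lam k `^ s in l0 *.
  have xy : 0 <= x * y by apply: mulr_ge0; exact: normr_ge0.
  rewrite -(ler_pM2l l0) mulrDr !mulrA divff ?gt_eqF// mul1r.
  have : 0 <= l * (x * y) by rewrite mulr_ge0// ltW.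
  have := sqr_ge0 (x - l * y).
  nra.
rewrite (_ : pair_sum u = series (fun k => a k * inner Omega u (phi k))).
  exact: normed_cvg.
by apply/funext => n; rewrite /series/= big_mkord.
Qed.

(** The limit functional takes the value a_k at phi_k, so the dual distance to
    it is again the root of a tail. *)
Lemma cvg_in_dot_space_lt0 (t : R) : t < 0 ->
  (\sum_(0 <= k <oo) (lam k `^ t * a k ^+ 2)%:E < +oo)%E ->
  cvg_in_dot_space Omega lam phi t (partial_sum phi a).
Proof.
move=> t0 aoo; rewrite /cvg_in_dot_space leNgt t0/=.
have tE : - - t = t by rewrite opprK.
have b0 k : 0 <= lam k `^ t * a k ^+ 2 by have := sq0 t a k; rewrite lee_fin.
have cP u : dot_space Omega lam phi (- t) u -> cvgn (pair_sum u).
  by apply: pair_sum_cvg; rewrite tE.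
have Fphi k : limn (pair_sum (phi k)) = a k.
  apply: cvg_lim => //; apply: cvg_near_cst; near=> n.
  rewrite /pair_sum; under eq_bigr do rewrite innerC.
  rewrite (sum_orthonormal ophi) (_ : (k < n)%N)//.
  by near: n; exact: nbhs_infty_gt.
exists (fun u => limn (pair_sum u)).
  split.
    move=> c u v du dv; apply: cvg_lim => //.
    have -> : pair_sum (fun x => c * u x + v x) =
              (fun n => c * pair_sum u n + pair_sum v n).
      apply/funext => n; rewrite /pair_sum mulr_sumr -big_split/=.
      apply: eq_bigr => k _; case: du => Lu _; case: dv => Lv _.
      by rewrite (inner_lin mO)// mulrDr mulrCA.
    by apply: cvgD; [apply: cvgMr; exact: cP|exact: cP].
  pose A := fine (\sum_(0 <= k <oo) (lam k `^ t * a k ^+ 2)%:E)%E.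
  exists (Num.sqrt A) => u du.
  have [Lu] := du; rewrite /dot_norm => uoo.
  set S := (\sum_(0 <= k <oo) _)%E in uoo *.
  have S0 : (0 <= S)%E.
    apply: nneseries_ge0 => k _ _.
    exact: (sq0 _ (fun k => inner Omega u (phi k))).
  have Sf : S \is a fin_num by rewrite -sqrte_fin_num// ge0_fin_numE ?sqrte_ge0.
  rewrite -(fineK Sf) /= -EFinM lee_fin -sqrtrM; last first.
    by apply: fine_ge0; exact: nneseries_ge0.
  have cu : `|pair_sum u n| @[n --> \oo] --> `|limn (pair_sum u)|.
    by apply: cvg_norm; exact: cP.
  apply: (@cvgr_to_le _ _ _ _ (fun n => `|pair_sum u n|) _ _ cu).
  apply: nearW => n.
  rewrite -sqrtr_sqr ler_sqrt; last first.
    by rewrite mulr_ge0 ?fine_ge0// nneseries_ge0.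
  rewrite /pair_sum.
  (* The weight of order t is split evenly between the two factors. *)
  have -> : \sum_(k < n) a k * inner Omega u (phi k) =
    \sum_(k < n) (lam k `^ (t / 2) * a k) *
                  (lam k `^ (- t / 2) * inner Omega u (phi k)).
    apply: eq_bigr => k _; rewrite mulrACA -powRD; last first.
      by rewrite (gt_eqF (lam_gt0 k)) implybT.
    by rewrite mulNr subrr powRr0 mul1r.
  apply: le_trans (sum_CauchySchwarz n (fun k => lam k `^ (t / 2) * a k)
    (fun k => lam k `^ (- t / 2) * inner Omega u (phi k))) _.
  have sqE (r : R) k (c : nat -> R) :
      (lam k `^ (r / 2) * c k) ^+ 2 = lam k `^ r * c k ^+ 2.
    rewrite exprMn expr2 -powRD ?(gt_eqF (lam_gt0 k)) ?implybT//.
    by rewrite -splitr.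
  have bd (r : R) (c : nat -> R) :
     (\sum_(0 <= k <oo) (lam k `^ r * c k ^+ 2)%:E)%E \is a fin_num ->
     \sum_(k < n) (lam k `^ (r / 2) * c k) ^+ 2 <=
     fine (\sum_(0 <= k <oo) (lam k `^ r * c k ^+ 2)%:E)%E.
    move=> cf; under eq_bigr do rewrite sqE.
    rewrite -lee_fin fineK//.
    rewrite -(big_mkord xpredT (fun k => lam k `^ r * c k ^+ 2)) -sumEFin.
    by apply: nneseries_lim_ge => k _ _.
  apply: ler_pM; try by apply: sumr_ge0 => k _; exact: sqr_ge0.
    by apply: bd; rewrite ge0_fin_numE// nneseries_ge0.
  exact: (bd _ (fun k => inner Omega u (phi k))).
have := sqrte_tail_cvg0 b0 aoo; apply: cvg_trans; apply: near_eq_cvg.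
apply: nearW => n; rewrite /dual_norm; congr sqrte; apply: eq_eseriesr => k _.
by rewrite Fphi (inner_partial_sum mO)// sub_trunc mulrnAr tE.
Unshelve. all: by end_near.
Qed.

End dot_space_convergence.

(** * Random coefficients *)

(** Integrating term by term, the expectation of the sum is the sum of the
    [b k]; a nonnegative variable of finite expectation is almost surely
    finite. *)
Lemma ae_weighted_sqr_series_fin (R : realType) (disp : measure_display)
    (Xi : measurableType disp) (mu : probability Xi R)
    (w : nat -> {RV mu >-> R}) (b : nat -> R) :
  (forall k, ('E_mu[w k] = 0)%E) -> (forall k, ('V_mu[w k] = 1)%E) ->
  (forall k, 0 <= b k) -> (\sum_(0 <= k <oo) (b k)%:E < +oo)%E ->
  {ae mu, forall xi, (\sum_(0 <= k <oo) (b k * w k xi ^+ 2)%:E < +oo)%E}.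
Proof.
move=> Ew Vw b0 boo.
have w2 k : (\int[mu]_x ((w k x ^+ 2)%:E) = 1)%E.
  rewrite -(Vw k) /variance covariance.unlock Ew expectation.unlock /=.
  by apply: eq_integral => x _; rewrite -[in LHS](subr0 (w k x)) expr2.
have s0 k x : (0 <= (b k * w k x ^+ 2)%:E)%E.
  by rewrite lee_fin mulr_ge0// sqr_ge0.
have mw k : measurable_fun setT (fun x => (w k x ^+ 2)%:E).
  by apply/measurable_EFinP; exact: measurable_funX.
have ms k : measurable_fun setT (fun x => (b k * w k x ^+ 2)%:E).
  apply/measurable_EFinP; apply: measurable_funM => //.
  exact: measurable_funX.
have I : mu.-integrable setT
    (fun x => (\sum_(0 <= k <oo) (b k * w k x ^+ 2)%:E)%E).
  apply/integrableP; split.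
    by apply: ge0_emeasurable_sum => // k x _ _; exact: s0.
  under eq_integral do rewrite gee0_abs ?nneseries_ge0//.
  rewrite integral_nneseries//.
  rewrite (eq_eseriesr (g := fun k => (b k)%:E))// => k _.
  under eq_integral do rewrite EFinM.
  rewrite ge0_integralZl_EFin//; last by move=> x _; rewrite lee_fin sqr_ge0.
  by rewrite w2 mule1.
apply: filterS (integrable_ae measurableT I) => x /(_ Logic.I).
by rewrite ge0_fin_numE// nneseries_ge0.
Qed.

(** This is where the order 1 - d/2 comes from: with t = 1 - d/2 - eps, the
    terms are at most lam_k^(t - 1), hence at most a multiple of
    k^(2 (t - 1) / d), and 2 (t - 1) / d = - 1 - 2 eps / d. *)
Lemma weyl_series_fin (R : realType) (d : nat) (lam : nat -> R) (c eps : R) :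
  (0 < d)%N -> 0 < c -> 0 < eps -> (forall k, 0 < lam k) ->
  (forall k, c * k.+1%:R `^ (2 / d%:R) <= lam k) ->
  (\sum_(0 <= k <oo) (lam k `^ (1 - d%:R / 2 - eps) / (1 + lam k))%:E < +oo)%E.
Proof.
move=> d0 c0 e0 l0 lc.
have dR : 0 < d%:R :> R by rewrite ltr0n.
pose q : R := d%:R / 2 + eps.
have q0 : 0 < q by rewrite addr_gt0// divr_gt0.
pose p := 2 * eps / d%:R.
have p0 : 0 < p by rewrite divr_gt0// mulr_gt0.
have le k : lam k `^ (1 - d%:R / 2 - eps) / (1 + lam k) <=
    (c `^ q)^-1 * riemannR (1 + p) k.
  have -> : 1 - d%:R / 2 - eps = 1 - q by rewrite /q opprD addrA.
  rewrite powRD ?(gt_eqF (l0 k)) ?implybT// powRr1 ?(ltW (l0 k))//.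
  apply: (@le_trans _ _ (lam k `^ (- q))).
    rewrite ler_pdivrMr ?addr_gt0// mulrC ler_wpM2l ?powR_ge0//.
    by rewrite lerDr.
  rewrite powRN -invfM lef_pV2 ?posrE ?mulr_gt0 ?powR_gt0//.
  have -> : 1 + p = 2 / d%:R * q by rewrite /p /q; field; rewrite gt_eqF.
  rewrite powRrM -powRM ?powR_ge0 ?(ltW c0)//.
  by rewrite ge0_ler_powR ?nnegrE ?(ltW q0) ?(ltW (l0 k)) ?mulr_ge0 ?powR_ge0
    ?(ltW c0).
apply: (@le_lt_trans _ _
    (\sum_(0 <= k <oo) ((c `^ q)^-1%:E * (riemannR (1 + p) k)%:E))%E).
  apply: lee_nneseries => k _; last by rewrite -EFinM lee_fin.
  by rewrite lee_fin divr_ge0 ?powR_ge0 ?addr_ge0 ?(ltW (l0 k)).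
rewrite nneseriesZl; last by move=> k _; rewrite lee_fin invr_ge0 powR_ge0.
rewrite lte_mul_pinfty ?riemannR_series_bounded//.
by rewrite lee_fin invr_ge0 powR_ge0.
Qed.

Unset Implicit Arguments.

Theorem lemma3p1 (R : realType) (d : nat) (hd : (1 <= d)%N)
    (Omega : set 'rV[R]_d)
    (hbounded : bounded_set Omega)
    (hopen : open Omega)
    (hconnected : connected Omega)
    (hlipschitz : lipschitz_boundary Omega)
    (lam : nat -> R) (phi : nat -> 'rV[R]_d -> R)
    (hbasis : orthonormal_basis Omega phi)
    (heigen : forall k, dirichlet_eigenfunction Omega (lam k) (phi k))
    (hpos : 0 < lam 0%N)
    (hmono : forall k, lam k <= lam k.+1)
    (hweyl : exists c C : R, [/\ 0 < c, 0 < C &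
       forall k, c * k.+1%:R `^ (2 / d%:R) <= lam k
                 <= C * k.+1%:R `^ (2 / d%:R)])
    (disp : measure_display) (Xi : measurableType disp)
    (mu : probability Xi R)
    (w : nat -> {RV mu >-> R})
    (hindep : independent_RVs w)
    (hmean : forall k, ('E_mu[w k] = 0)%E)
    (hvar : forall k, ('V_mu[w k] = 1)%E)
    (tau : R) (htau : 0 < tau)
    (eps : R) (heps : 0 < eps) :
  {ae mu, forall xi,
    cvg_in_dot_space Omega lam phi (1 - d%:R / 2 - eps)
      (fun n => Phi_ lam phi tau w n xi)}.
Proof.
have mO := open_measurable_rV hopen.
have [Lphi ophi _] := hbasis.
have lge k : lam 0%N <= lam k.
  by elim: k => // k IH; exact: le_trans IH (hmono k).
have l0 k : 0 < lam k by exact: lt_le_trans hpos (lge k).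
have [c [C [c0 _ weyl]]] := hweyl.
have lc k : c * k.+1%:R `^ (2 / d%:R) <= lam k by case/andP: (weyl k).
set t := 1 - d%:R / 2 - eps.
pose b k := tau ^+ 2 * (lam k `^ t / (1 + lam k)).
have b0 k : 0 <= b k.
  by rewrite /b mulr_ge0 ?sqr_ge0// divr_ge0 ?powR_ge0// addr_ge0// ltW.
have boo : (\sum_(0 <= k <oo) (b k)%:E < +oo)%E.
  under eq_eseriesr do rewrite EFinM.
  rewrite nneseriesZl; last first.
    by move=> k _; rewrite lee_fin divr_ge0 ?powR_ge0// addr_ge0// ltW.
  by rewrite lte_mul_pinfty ?(weyl_series_fin hd c0 heps l0 lc)// lee_fin
    sqr_ge0.
apply: filterS (ae_weighted_sqr_series_fin hmean hvar b0 boo).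
move=> xi Sxi.
pose a k := tau * ((1 + lam k) `^ (- 2^-1) * w k xi).
have -> : (fun n => Phi_ lam phi tau w n xi) = partial_sum phi a.
  apply/funext => n; apply/funext => x; rewrite /Phi_ /partial_sum mulr_sumr.
  by apply: eq_bigr => k _; rewrite /a !mulrA.
have aoo : (\sum_(0 <= k <oo) (lam k `^ t * a k ^+ 2)%:E < +oo)%E.
  rewrite (eq_eseriesr (g := fun k => (b k * w k xi ^+ 2)%:E))// => k _.
  have l1 : 0 < 1 + lam k by rewrite addr_gt0.
  congr EFin; rewrite /a /b !exprMn.
  have -> : ((1 + lam k) `^ (- 2^-1)) ^+ 2 = (1 + lam k)^-1.
    by rewrite powRN exprVn powR12_sqrt ?(ltW l1)// sqr_sqrtr// ltW.
  by ring.
have [t0|t0] := leP 0 t.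
  exact: (cvg_in_dot_space_ge0 mO).
exact: (cvg_in_dot_space_lt0 mO).
Qed.
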